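(* For every integer $m\ge 1$, the Lie group $SU(2)^m:=SU(2)\times\cdots\times SU(2)$ ($m$ times) admits no left-invariant hypercomplex structure.
   Context: A hypercomplex structure on a manifold $M$ is a triple $(I,J,K)$ of integrable almost complex structures on $M$ which pairwise anti-commute and satisfy $IJ=K$. A structure on a Lie group $G$ is left-invariant if each of $I,J,K$ commutes with the differentials of all left translations. Equivalently, with $\mathfrak g$ the Lie algebra of left-invariant vector fields of $G$ (identified with $T_eG$), a left-invariant integrable almost complex structure on $G$ is a linear map $J:\mathfrak g\to\mathfrak g$ with $J^2=-\mathrm{id}_{\mathfrak g}$ and $N_J(X,Y)=0$ for all $X,Y\in\mathfrak g$, where $N_J(X,Y):=J[JX,Y]+J[X,JY]+[X,Y]-[JX,JY]$; a left-invariant hypercomplex structure on $G$ is a triple $(I,J,K)$ of such linear maps on $\mathfrak g$ which pairwise anti-commute and satisfy $IJ=K$. *)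

(* Defs.v *)
From HB Require Import structures.
From mathcomp Require Import all_boot all_order all_algebra.
From mathcomp Require Import complex.
From mathcomp Require Import all_classical all_reals all_analysis.

Set Implicit Arguments.
Unset Strict Implicit.
Unset Printing Implicit Defensive.

Import Order.TTheory GRing.Theory Num.Theory.
Import numFieldNormedType.Exports.

Local Open Scope classical_set_scope.
Local Open Scope ring_scope.
Local Open Scope complex_scope.

(** The ambient real associative algebra of m-tuples of complex 2 x 2 matrices.
    The library makes it a module over R[i] only, so a real scalar a acts
    through a%:C. *)
Definition ambient (R : realType) (m : nat) := {ffun 'I_m -> 'M[R[i]]_2}.

Definition SU2 (R : realType) : set 'M[R[i]]_2 :=
  [set U | U \is unitarymx /\ \det U = 1].
Arguments SU2 : clear implicits.

Definition SU2_pow (R : realType) (m : nat) : set (ambient R m) :=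
  [set g | forall k, SU2 R (g k)].
Arguments SU2_pow : clear implicits.

Section LieAlgebra.
Variables (R : realType) (m : nat).
Local Notation V := (ambient R m).
Implicit Types (G g : set V) (c : R -> V) (I J K : V -> V) (X Y : V).

Definition id_elt : V := [ffun => 1%:M].

Definition smooth (f : R -> R) : Prop :=
  forall n (t : R), @derivable R R R (f^`(n))%classic t 1.

Definition smooth_curve c : Prop :=
  forall k i j, smooth (fun t => complex.Re (c t k i j)) /\
                smooth (fun t => complex.Im (c t k i j)).

Definition has_velocity0 c X : Prop :=
  forall k i j,
    is_derive (0 : R) 1 (fun t => complex.Re (c t k i j)) (complex.Re (X k i j)) /\
    is_derive (0 : R) 1 (fun t => complex.Im (c t k i j)) (complex.Im (X k i j)).

(** [lie_algebra G] is T_e G, for G a Lie group embedded in the units of the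
    ambient algebra.  The field g |-> g X is the left-invariant vector field
    with value X at e, so the bracket of left-invariant vector fields becomes
    the commutator on T_e G. *)
Definition lie_algebra G : set V :=
  [set X | exists c, [/\ smooth_curve c, forall t, G (c t),
                         c 0 = id_elt & has_velocity0 c X]].

Definition lie_bracket X Y : V := [ffun k => X k *m Y k - Y k *m X k].

(** A linear endomorphism of a real subspace g is encoded by a map on the
    ambient space, of which only the restriction to g matters. *)
Definition linear_endo g J : Prop :=
  (forall X, g X -> g (J X)) /\
  (forall (a : R) X Y, g X -> g Y -> J (a%:C *: X + Y) = a%:C *: J X + J Y).

Definition nijenhuis J X Y : V :=
  J (lie_bracket (J X) Y) + J (lie_bracket X (J Y))
  + lie_bracket X Y - lie_bracket (J X) (J Y).

Definition complex_structure g J : Prop :=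
  [/\ linear_endo g J,
      forall X, g X -> J (J X) = - X &
      forall X Y, g X -> g Y -> nijenhuis J X Y = 0].

Definition anticommute g I J : Prop :=
  forall X, g X -> I (J X) = - J (I X).

Definition hypercomplex_structure g I J K : Prop :=
  [/\ complex_structure g I, complex_structure g J & complex_structure g K] /\
  [/\ anticommute g I J, anticommute g J K, anticommute g I K &
      forall X, g X -> I (J X) = K X].

Definition admits_left_invariant_hypercomplex G : Prop :=
  exists I J K, hypercomplex_structure (lie_algebra G) I J K.

End LieAlgebra.

(* Main.v *)
Require Import Defs.
From HB Require Import structures.
From mathcomp Require Import all_boot all_order all_algebra.
From mathcomp Require Import complex.
From mathcomp Require Import all_classical all_reals all_analysis.
From mathcomp Require Import ring lra.

(** Write g for the Lie algebra su(2)^m with an ad-invariant inner product <,>,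
    and [tau_I X = tr (I ad X) = <v_I, X>] for the Koszul form of a complex
    structure I on g, with dual vector v_I.  The proof compares the centralizer
    of v_I for two members I, J of a hypercomplex triple.

    One complex structure.  Let q be the i-eigenspace of I in the
    complexification of g, a subalgebra by integrability.  Up to a factor,
    tau_I is the value at q of the moment map for the action of the compact
    group on the Grassmannian containing q, so tau_I [X, IX] is, up to a
    negative factor, the squared norm of the displacement of q by the conjugate
    of X - i IX.  Hence tau_I [X, IX] = 0 forces I to commute with ad X
    ([koszul_bracketJ], [commutes_of_koszul_commutes]); this holds in
    particular when [X, v_I] = 0.  If v_I were zero, I would commute with all
    ad X, and g would be a complex Lie algebra with a real invariant inner
    product, hence abelian; so v_I is nonzero ([koszul_neq0]).

    Two complex structures.  The trace of the torsion-free connection that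
    preserves I, J and K (the Obata connection) is X |-> tau_I (IX), and it is
    also X |-> tau_J (JX) ([mxtrace_hypercomplex]).  So the vector u with
    <u, X> = tau_I (IX) is nonzero and the same for I and J.

    Rank one factors.  Choose a factor k with component u_k of u nonzero.  The
    component of v_I in that factor commutes with v_I, hence ad of it commutes
    with I, hence it commutes with u: so u_k commutes with v_I, and ad u_k
    commutes with I.  In the same way ad u_k commutes with J.  The
    image of ad u_k is the plane orthogonal to u_k in one copy of su(2), where
    ad u_k is a multiple of a rotation by a right angle.  Linear maps of a
    plane that commute with such a rotation commute with each other, but I and
    J anticommute: a contradiction ([quaternions_not_on_plane]).

    It remains to identify the tangent space of SU(2)^m at the identity,
    defined by velocities of smooth curves, with tuples of traceless
    skew-hermitian matrices: one inclusion differentiates the equations of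
    SU(2), the other uses the one-parameter groups
    cos (r t) + sin (r t) / r X, where r^2 = det X. *)

Set Implicit Arguments.
Unset Strict Implicit.
Unset Printing Implicit Defensive.

Import Order.TTheory GRing.Theory Num.Theory.
Import numFieldNormedType.Exports.

Local Open Scope ring_scope.
Local Open Scope complex_scope.

(** * Real matrices with square -1 *)

Section Matrices.
Variable R : realFieldType.

Lemma sqnorm_ge0 m p (A : 'M[R]_(m, p)) : 0 <= \tr (A *m A^T).
Proof.
rewrite /mxtrace sumr_ge0 // => i _; rewrite mxE sumr_ge0 // => j _.
by rewrite mxE -expr2 sqr_ge0.
Qed.

Lemma sqnorm_eq0 m p (A : 'M[R]_(m, p)) : \tr (A *m A^T) = 0 -> A = 0.
Proof.
move/eqP; rewrite /mxtrace psumr_eq0 => [/allP A0|i _]; last first.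
  by rewrite mxE sumr_ge0 // => j _; rewrite mxE -expr2 sqr_ge0.
apply/matrixP => i j; rewrite mxE; move: (A0 i (mem_index_enum _)).
rewrite /= mxE psumr_eq0 => [/allP /(_ j (mem_index_enum _))|k _] /=.
  by rewrite mxE mulf_eq0 orbb => /eqP.
by rewrite mxE -expr2 sqr_ge0.
Qed.

Lemma mxtrace_skew n (A : 'M[R]_n) : A^T = - A -> \tr A = 0.
Proof.
move=> skA; have := mxtrace_tr A; rewrite skA raddfN /= => h; lra.
Qed.

Lemma mxtrace_skew_sym n (A S : 'M[R]_n) :
  A^T = - A -> S^T = S -> \tr (A *m S) = 0.
Proof.
move=> skA syS; have := mxtrace_tr (A *m S).
by rewrite trmx_mul skA syS mulmxN raddfN /= mxtrace_mulC => h; lra.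
Qed.

Variables (n : nat) (I : 'M[R]_n).
Hypothesis I2 : I *m I = - 1%:M.
Implicit Types A B E S : 'M[R]_n.

Lemma mulII A : I *m (I *m A) = - A.
Proof. by rewrite mulmxA I2 mulNmx mul1mx. Qed.

Lemma trII : I^T *m I^T = - 1%:M.
Proof. by rewrite -trmx_mul I2 linearN /= trmx1. Qed.

(** The orthogonal projection of complex row vectors onto the i-eigenspace of I
    is [M *m (1 - i I)] with M this matrix: M is the real part of the
    projection, and [- M *m I] its imaginary part.  The lemmas below are the
    relations that make it a hermitian idempotent with that image. *)
Definition herm_proj : 'M[R]_n := invmx (1%:M + I *m I^T).
Local Notation G := (1%:M + I *m I^T).
Local Notation M := herm_proj.

Lemma gram_unit : G \in unitmx.
Proof.
rewrite -row_free_unit; apply: inj_row_free => x xG0; apply: sqnorm_eq0.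
have: \tr (x *m G *m x^T) = 0 by rewrite xG0 mul0mx mxtrace0.
rewrite mulmxDr mulmx1 mulmxDl mxtraceD.
have -> : x *m (I *m I^T) *m x^T = (x *m I) *m (x *m I)^T.
  by rewrite trmx_mul !mulmxA.
by have := sqnorm_ge0 x; have := sqnorm_ge0 (x *m I); lra.
Qed.

Lemma tr_herm_proj : M^T = M.
Proof.
by rewrite /herm_proj trmx_inv linearD /= trmx1 trmx_mul trmxK.
Qed.

Lemma gram_tr : G *m I^T = I^T - I.
Proof. by rewrite mulmxDl mul1mx -mulmxA trII mulmxN mulmx1. Qed.

Lemma gram_l : I *m G = I - I^T.
Proof. by rewrite mulmxDr mulmx1 mulII. Qed.

Lemma herm_proj_skew : I^T *m M = - (M *m I).
Proof.
have := congr1 (fun A => M *m A *m M) gram_l.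
rewrite !mulmxA mulmxK ?gram_unit // => ->.
by rewrite -[I - _]opprB -gram_tr mulmxN mulNmx mulKmx ?gram_unit // opprK.
Qed.

Lemma herm_projD : I *m M + M *m I = I.
Proof.
have := congr1 (fun A => A *m M) gram_l.
by rewrite mulmxK ?gram_unit // mulmxBl herm_proj_skew opprK => /esym.
Qed.

Lemma herm_proj_split : M = M *m M^T + (M *m I) *m (M *m I)^T.
Proof.
rewrite trmx_mul tr_herm_proj; have : M *m G *m M = M.
  by rewrite mulVmx ?mul1mx ?gram_unit.
by rewrite mulmxDr mulmx1 mulmxDl !mulmxA => ->.
Qed.

Lemma herm_projC_split :
  1%:M - M = (1%:M - M) *m (1%:M - M)^T + (M *m I) *m (M *m I)^T.
Proof.
rewrite linearB /= trmx1 tr_herm_proj mulmxBl mul1mx mulmxBr mulmx1.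
have {3}-> : M = M *m M + M *m I *m (M *m I)^T.
  by rewrite {1}herm_proj_split tr_herm_proj.
by rewrite [M *m M + _]addrC addrK subrK.
Qed.

(** [M] and [1 - M] are positive semidefinite: by the two splittings the trace
    is a sum of four squared norms, and two of them already determine E. *)
Lemma herm_energy_eq0 E :
  \tr (M *m E *m (1%:M - M) *m E^T) = 0 -> E = 0.
Proof.
have := herm_projC_split; move: (1%:M - M) (subrK M 1%:M) => N NM.
have := herm_proj_split; set P := M *m I => MM NN E0.
have sq (C D : 'M[R]_n) : \tr ((C *m C^T) *m E *m (D *m D^T) *m E^T)
   = \tr ((C^T *m E *m D) *m (C^T *m E *m D)^T).
  by rewrite !trmx_mul trmxK -!mulmxA mxtrace_mulC !mulmxA.
have [a0 b0] : M *m E *m N = 0 /\ M *m E *m P = 0.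
  move: E0; rewrite {1}MM {1}NN !(mulmxDl, mulmxDr) !mxtraceD !sq tr_herm_proj.
  have := sqnorm_ge0 (M *m E *m N); have := sqnorm_ge0 (M *m E *m P).
  have := sqnorm_ge0 (P^T *m E *m N); have := sqnorm_ge0 (P^T *m E *m P).
  by move=> *; split; apply: sqnorm_eq0; lra.
(* [M *m E] is annihilated by [1 - M] and by M, whose sum is 1. *)
have ME0 : M *m E = 0.
  rewrite -[LHS]mulmx1 -NM mulmxDr a0 add0r.
  have /eqP : M *m E *m P *m I = 0 by rewrite b0 mul0mx.
  by rewrite /P -!mulmxA I2 !mulmxN mulmx1 oppr_eq0 => /eqP.
by rewrite -[E]mul1mx -(mulmxV gram_unit) -mulmxA ME0 mulmx0.
Qed.
End Matrices.

(** * Complex structures on a Lie algebra with invariant inner product *)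

(** Vectors are rows and maps act on the right: the bracket of X and Y is
    [Y *m ad X], and the matrix of a composition f o g is that of g times that
    of f.  The inner product is the standard one. *)
Section CompactLieAlgebra.
Variables (R : realFieldType) (n : nat) (ad : {linear 'rV[R]_n -> 'M[R]_n}).
Hypothesis ad_skew : forall X, (ad X)^T = - ad X.
Hypothesis adC : forall X Y, Y *m ad X = - (X *m ad Y).
Hypothesis ad_bracket :
  forall X Y, ad (Y *m ad X) = ad Y *m ad X - ad X *m ad Y.
Implicit Types (I J K A B : 'M[R]_n) (X Y v : 'rV[R]_n).

(** The vanishing of the Nijenhuis tensor N_I(X, Y), as an identity between
    endomorphisms in the variable Y. *)
Definition integrable I := forall X,
  ad (X *m I) *m I - I *m ad (X *m I) + I *m ad X *m I + ad X = 0.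

(** The vector dual to the Koszul form X |-> tr (I ad X). *)
Definition koszul I : 'rV[R]_n := \row_j \tr (I *m ad (delta_mx 0 j)).

Lemma koszulE I X : \tr (I *m ad X) = (X *m (koszul I)^T) 0 0.
Proof.
rewrite {1}[X]row_sum_delta linear_sum mulmx_sumr linear_sum mxE /=.
apply: eq_bigr => j _; rewrite linearZ /= -scalemxAr mxtraceZ.
by rewrite !mxE.
Qed.

Lemma mxtrace_ad X : \tr (ad X) = 0.
Proof. exact: mxtrace_skew. Qed.

Section Complex.
Variable I : 'M[R]_n.
Hypothesis I2 : I *m I = - 1%:M.
Hypothesis N_I : integrable I.
Local Notation M := (herm_proj I).

Let MI_IM : M *m I = I - I *m M.
Proof. by apply: (addrI (I *m M)); rewrite herm_projD // [RHS]addrC subrK. Qed.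

Let IM_MI : I *m M = I - M *m I.
Proof. by apply: (addIr (M *m I)); rewrite herm_projD // subrK. Qed.

(** For x in the subalgebra q of (1,0)-vectors, tr (P ad x) is the trace of ad x
    on q for every projection P onto q.  This compares the orthogonal
    projection with the projection along the conjugate of q. *)
Lemma koszul_herm_proj X : \tr (I *m ad X) = 2 * \tr (M *m I *m ad X).
Proof.
have [Y ->] : exists Y, X = Y *m I.
  by exists (- (X *m I)); rewrite mulNmx -mulmxA I2 mulmxN mulmx1 opprK.
have := congr1 (fun A => \tr (M *m A)) (N_I Y).
rewrite mulmx0 mxtrace0 !mulmxDr mulmxN !mxtraceD linearN /=.
set B := ad _; set A := ad _.
have -> : \tr (M *m (B *m I)) = \tr (I *m B) - \tr (M *m I *m B).
  by rewrite mulmxA mxtrace_mulC mulmxA IM_MI mulmxBl linearB.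
have -> : \tr (M *m A) = 0.
  by rewrite mxtrace_mulC (mxtrace_skew_sym (ad_skew _) (tr_herm_proj I)).
have -> : \tr (M *m (I *m A *m I)) = 0.
  rewrite !mulmxA mxtrace_mulC !mulmxA IM_MI mulmxBl I2 -[_ *m I *m I]mulmxA I2.
  rewrite mulmxN mulmx1 mulmxBl mulNmx mul1mx mulNmx opprK linearD linearN /=.
  by rewrite mxtrace_ad mxtrace_mulC (mxtrace_skew_sym (ad_skew _)
    (tr_herm_proj I)) oppr0 add0r.
rewrite !mulmxA => h; lra.
Qed.

(** With P the orthogonal projection onto q, x = X - i IX and y its conjugate,
    N = (1 - P) (ad y) P measures how far y is from normalizing q.  Since x
    normalizes q and the adjoint of ad y is - ad x, the squared norm of N is
    - tr (P [ad x, ad y]) = - tr (P ad [x, y]), and [x, y] = 2i [X, IX].  By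
    integrability N is determined by E, and up to a positive factor its squared
    norm is the trace on the right. *)
Lemma koszul_bracketJ X (E := ad X + I *m ad X *m I) :
  \tr (I *m ad (X *m I *m ad X)) =
    - 2 * \tr (M *m E *m (1%:M - M) *m E^T).
Proof.
rewrite koszul_herm_proj ad_bracket.
have := N_I X; set B := ad (X *m I); set A := ad X => NX.
have EB : E = I *m B - B *m I.
  by apply/eqP; rewrite -subr_eq0 opprB addrC /E -/A [A + _]addrC addrA NX.
have [N defN] : exists N, N = 1%:M - M by eexists.
rewrite -defN.
have IN : I *m N = M *m I by rewrite defN mulmxBr mulmx1 MI_IM.
have trM := tr_herm_proj I.
have trMI : (M *m I)^T = - (M *m I) by rewrite trmx_mul trM herm_proj_skew.
have NIt : N *m I^T = - (M *m I).
  by rewrite -trMI -IN trmx_mul defN linearB /= trmx1 trM.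
have EI : I *m E = - (E *m I).
  rewrite EB mulmxBr mulmxBl mulII // -[B *m I *m I]mulmxA I2.
  by rewrite mulmxN mulmx1 opprK opprD mulmxA addrC.
have EtE : E^T = - (A + I^T *m A *m I^T).
  by rewrite /E linearD /= !trmx_mul ad_skew mulNmx mulmxN -opprD mulmxA.
have MENA : \tr (M *m E *m N *m E^T) = - 2 * \tr (M *m E *m N *m A).
  suff h : \tr (M *m E *m N *m (I^T *m A *m I^T)) = \tr (M *m E *m N *m A).
    by rewrite EtE mulmxN mulmxDr linearN /= mxtraceD h; ring.
  rewrite !mulmxA mxtrace_mulC !mulmxA herm_proj_skew //.
  rewrite -[_ *m N *m I^T]mulmxA NIt.
  rewrite !(mulmxN, mulNmx) opprK -[M *m I *m E]mulmxA EI.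
  rewrite !(mulmxN, mulNmx) -[M *m (E *m I) *m _]mulmxA.
  have -> : E *m I *m (M *m I) = - (E *m N).
    rewrite -mulmxA [I *m (M *m I)]mulmxA IM_MI mulmxBl I2 -[_ *m I *m I]mulmxA.
    by rewrite I2 mulmxN mulmx1 -opprD mulmxN defN.
  by rewrite mulmxN mulNmx opprK !mulmxA.
have MBA : \tr (M *m E *m N *m A) = \tr (M *m I *m B *m A).
  rewrite EB mulmxBr !mulmxBl linearB /= !mulmxA -[M *m B *m I *m N]mulmxA IN.
  rewrite ?mulmxA defN.
  rewrite mulmxBr mulmx1 mulmxBl linearB /= ?mulmxA.
  suff -> : \tr (M *m B *m M *m I *m A) = - \tr (M *m I *m B *m M *m A).
    by rewrite opprK subrK.
  rewrite -mxtrace_tr -[_ *m M *m I]mulmxA trmx_mul [(_ *m (M *m I))^T]trmx_mul.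
  rewrite trMI trmx_mul !ad_skew trM.
  by rewrite !(mulmxN, mulNmx) opprK linearN /= mxtrace_mulC !mulmxA
    mxtrace_mulC !mulmxA.
rewrite MENA MBA mulmxBr linearB /=.
suff -> : \tr (M *m I *m (A *m B)) = - \tr (M *m I *m B *m A).
  by rewrite mulmxA; ring.
rewrite -mxtrace_tr trmx_mul trMI trmx_mul !ad_skew !(mulmxN, mulNmx) opprK.
by rewrite linearN /= mxtrace_mulC mulmxA.
Qed.

(** If X commutes with the Koszul vector v then <v, [X, IX]> = <[v, X], IX> = 0,
    so the energy in [koszul_bracketJ] vanishes. *)
Lemma commutes_of_koszul_commutes X : X *m ad (koszul I) = 0 ->
  I *m ad X = ad X *m I.
Proof.
rewrite adC => /eqP; rewrite oppr_eq0 => /eqP kX.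
have E0 : ad X + I *m ad X *m I = 0.
  have aX : ad X *m (koszul I)^T = 0.
    by apply: trmx_inj; rewrite trmx_mul trmxK ad_skew mulmxN kX oppr0 trmx0.
  apply: (herm_energy_eq0 I2); have := koszul_bracketJ X.
  by rewrite koszulE -(mulmxA (X *m I)) aX mulmx0 mxE /= => h; lra.
have := congr1 (fun A => A *m I) E0.
by rewrite mul0mx mulmxDl -mulmxA I2 mulmxN mulmx1 => /subr0_eq.
Qed.

(** If the Koszul form vanished, I would commute with every ad X, whence
    ad (IX) = I ad X and tr ((ad (IX))^2) = - tr ((ad X)^2); but squares of skew
    matrices have nonpositive trace. *)
Lemma koszul_neq0 : (exists X, ad X != 0) -> koszul I != 0.
Proof.
case=> X adX0; apply: contra_neq adX0 => kI0.
have cI Y : I *m ad Y = ad Y *m I.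
  by apply: commutes_of_koszul_commutes; rewrite kI0 linear0 mulmx0.
have adI : ad (X *m I) = I *m ad X.
  apply/row_matrixP => i; rewrite !rowE.
  by rewrite adC -mulmxA cI mulmxA -mulNmx -adC -mulmxA -cI.
apply: sqnorm_eq0; have := sqnorm_ge0 (ad X); have := sqnorm_ge0 (ad (X *m I)).
rewrite !ad_skew adI !mulmxN {1}cI -mulmxA mulII // mulmxN !linearN /=.
by rewrite opprK; lra.
Qed.
End Complex.

(** The third structure K = IJ has matrix [J *m I]. *)
Section Hypercomplex.
Variables I J : 'M[R]_n.
Hypotheses (I2 : I *m I = - 1%:M) (J2 : J *m J = - 1%:M).
Hypothesis IJ : I *m J = - (J *m I).
Hypotheses (N_I : integrable I) (N_J : integrable J)
  (N_K : integrable (J *m I)).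

(** Both sides are the trace of the Obata connection in the direction X.
    Without the connection: multiply N_K (IX, -) = 0 by I and take the trace. *)
Lemma mxtrace_hypercomplex X : \tr (I *m ad (X *m I)) = \tr (J *m ad (X *m J)).
Proof.
have := congr1 (fun A => \tr (I *m A)) (N_K (X *m I)).
have -> : X *m I *m (J *m I) = X *m J.
  by rewrite -mulmxA [I *m (J *m I)]mulmxA IJ mulNmx -mulmxA I2 mulmxN mulmx1
    opprK.
set B := ad _; set A := ad _.
have KI : J *m I *m I = - J by rewrite -mulmxA I2 mulmxN mulmx1.
have IK : I *m (J *m I) = J by rewrite mulmxA IJ mulNmx KI opprK.
have KIK : J *m I *m I *m (J *m I) = I.
  by rewrite KI mulNmx mulmxA J2 mulNmx mul1mx opprK.
rewrite mulmx0 mxtrace0 !mulmxDr mulmxN !mxtraceD linearN /=.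
have -> : \tr (I *m (B *m (J *m I))) = - \tr (J *m B).
  by rewrite mulmxA mxtrace_mulC !mulmxA KI mulNmx linearN.
have -> : \tr (I *m (J *m I *m B)) = \tr (J *m B) by rewrite mulmxA IK.
have -> : \tr (I *m (J *m I *m A *m (J *m I))) = \tr (I *m A).
  by rewrite [I *m _]mulmxA mxtrace_mulC !mulmxA -(mulmxA _ J I) KIK.
lra.
Qed.

Lemma koszul_form_eq : koszul I *m I^T = koszul J *m J^T.
Proof.
apply/rowP => j.
have dual A : (koszul A *m A^T) 0 j = \tr (A *m ad (delta_mx 0 j *m A)).
  rewrite koszulE -mulmxA -rowE !mxE.
  by apply: eq_bigr => i _; rewrite !mxE mulrC.
by rewrite !dual mxtrace_hypercomplex.
Qed.
End Hypercomplex.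

(** For u = [koszul I *m I^T], which is dual to X |-> tr (I ad (IX)): pairing u
    with [X, Y] gives <v, I [X, Y]> = <v, [X, IY]> = <[v, X], IY> = 0. *)
Lemma koszul_form_commutes I X : I *m ad X = ad X *m I ->
  X *m ad (koszul I) = 0 -> X *m ad (koszul I *m I^T) = 0.
Proof.
move=> cI; rewrite !(adC _ X) => /eqP; rewrite oppr_eq0 => /eqP kX.
suff -> : koszul I *m I^T *m ad X = 0 by rewrite oppr0.
have cIt : I^T *m ad X = ad X *m I^T.
  by apply: trmx_inj; rewrite !trmx_mul !trmxK ad_skew mulNmx mulmxN cI.
by rewrite -mulmxA cIt mulmxA kX mul0mx.
Qed.
End CompactLieAlgebra.

(** * Quaternionic structures and planes *)

(** The second-last hypothesis makes the image of A the span of e and eA for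
    each nonzero e in it, and the last one says that A acts there with
    A^2 = c, as a complex unit does.  So I and J act on the image as elements
    of the commutative algebra generated by A, and cannot anticommute. *)
Lemma quaternions_not_on_plane (R : fieldType) n (A I J : 'M[R]_n) (c : R) :
  (2 : R) != 0 ->
  I *m I = - 1%:M -> J *m J = - 1%:M -> I *m J = - (J *m I) ->
  I *m A = A *m I -> J *m A = A *m J ->
  (forall p q : 'rV_n, p *m A != 0 ->
    exists s t, q *m A = s *: (p *m A) + t *: (p *m A *m A)) ->
  (forall p : 'rV_n, p *m A *m A *m A = c *: (p *m A)) ->
  A = 0.
Proof.
move=> two0 I2 J2 IJ IA JA plane A3;
  apply/eqP/rowV0Pn => -[_ /submxP[p ->] pA0].
have [s [t]] := plane p (p *m I) pA0; rewrite -mulmxA IA mulmxA => eI.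
have [s' [t']] := plane p (p *m J) pA0; rewrite -mulmxA JA mulmxA => eJ.
have eIJ : p *m A *m I *m J = p *m A *m J *m I.
  rewrite eI eJ !mulmxDl -!scalemxAl eI eJ.
  rewrite -(mulmxA _ A J) -JA -(mulmxA _ A I) -IA !mulmxA eI eJ.
  rewrite !mulmxDl -!scalemxAl A3 !scalerDr !scalerA.
  by apply/rowP => i; rewrite !mxE; ring.
have e0 : p *m A *m J *m I = 0.
  apply/eqP; rewrite -[_ == 0]orFb -(negPf two0) -scaler_eq0 scaler_nat mulr2n.
  by rewrite -{1}eIJ -mulmxA IJ mulmxN -mulmxA addNr.
move: pA0; rewrite -[_ *m A]opprK -[p *m A]mulmx1 -mulmxN -J2 mulmxA.
rewrite -[_ *m A *m J]mulmx1 -[1%:M]opprK -I2 mulmxN mulmxA e0.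
by rewrite mul0mx oppr0 mul0mx oppr0 eqxx.
Qed.

(** * The Lie algebra su(2)^m in coordinates *)

(** An element is an m x 3 matrix of coordinates, flattened to a row by
    [mxvec]. *)
Section Su2Power.
Variables (R : realFieldType) (m : nat).
Implicit Types (X Y Z : 'M[R]_(m, 3)) (x y z p q : 'rV[R]_(m * 3)).

Definition o0 : 'I_3 := @Ordinal 3 0 isT.
Definition o1 : 'I_3 := @Ordinal 3 1 isT.
Definition o2 : 'I_3 := @Ordinal 3 2 isT.

Lemma forall3 (P : 'I_3 -> Prop) : P o0 -> P o1 -> P o2 -> forall a, P a.
Proof.
move=> P0 P1 P2 [[|[|[|//]]] lt_a3].
- by rewrite (_ : Ordinal _ = o0) //; apply: val_inj.
- by rewrite (_ : Ordinal _ = o1) //; apply: val_inj.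
- by rewrite (_ : Ordinal _ = o2) //; apply: val_inj.
Qed.

(** Twice the cross product in each row: the bracket of su(2) in the basis
    i sigma_3, i sigma_2, i sigma_1. *)
Definition bracket X Y : 'M[R]_(m, 3) := \matrix_(k, a) nth 0
  [:: 2 * (X k o1 * Y k o2 - X k o2 * Y k o1);
      2 * (X k o2 * Y k o0 - X k o0 * Y k o2);
      2 * (X k o0 * Y k o1 - X k o1 * Y k o0)] a.

Lemma bracket_is_linear X : linear (bracket X).
Proof.
move=> c Y Z; apply/matrixP => k; apply: forall3; rewrite !mxE /=; ring.
Qed.

HB.instance Definition _ X :=
  GRing.isLinear.Build R _ _ _ (bracket X) (@bracket_is_linear X).

Definition su2_ad x : 'M[R]_(m * 3) := lin_mx (bracket (vec_mx x)).

Lemma vec_mx_su2_ad x y :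
  vec_mx (y *m su2_ad x) = bracket (vec_mx x) (vec_mx y).
Proof. by rewrite -[y in LHS]vec_mxK mul_vec_lin mxvecK. Qed.

Lemma vec_mxP x y : vec_mx x = vec_mx y -> x = y.
Proof. exact: (can_inj vec_mxK). Qed.

Lemma mulmx_rowP n (A B : 'M[R]_n) : (forall y : 'rV_n, y *m A = y *m B) ->
  A = B.
Proof. by move=> AB; apply/row_matrixP => i; rewrite !rowE. Qed.

Lemma su2_ad_is_linear : linear su2_ad.
Proof.
move=> c x y; apply: mulmx_rowP => z; apply: vec_mxP.
rewrite vec_mx_su2_ad mulmxDr -scalemxAr !linearP /= !vec_mx_su2_ad.
by apply/matrixP => k; apply: forall3; rewrite !mxE /=; ring.
Qed.

HB.instance Definition _ :=
  GRing.isLinear.Build R _ _ _ su2_ad su2_ad_is_linear.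

Lemma su2_adC x y : y *m su2_ad x = - (x *m su2_ad y).
Proof.
apply: vec_mxP; rewrite linearN /= !vec_mx_su2_ad.
by apply/matrixP => k; apply: forall3; rewrite !mxE /=; ring.
Qed.

Lemma su2_ad_bracket x y :
  su2_ad (y *m su2_ad x) = su2_ad y *m su2_ad x - su2_ad x *m su2_ad y.
Proof.
apply: mulmx_rowP => z; apply: vec_mxP.
rewrite mulmxBr !mulmxA linearB /= !vec_mx_su2_ad.
by apply/matrixP => k; apply: forall3; rewrite !mxE /=; ring.
Qed.

Lemma su2_ad_skew x : (su2_ad x)^T = - su2_ad x.
Proof.
apply/matrixP => i j; case/mxvec_indexP: i => k a; case/mxvec_indexP: j => l b.
rewrite !mxE /= !vec_mx_delta !mxvecE !mxE (eq_sym l).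
have [->|_] := eqVneq k l; rewrite /= ?mulr0 ?subrr ?mulr0.
  by move: a b; apply: forall3; apply: forall3; rewrite /=; ring.
by move: a b; apply: forall3; apply: forall3; rewrite /= oppr0.
Qed.

Definition factor (k : 'I_m) x : 'rV[R]_(m * 3) :=
  mxvec (\matrix_(l, a) ((l == k)%:R * vec_mx x l a)).

Lemma vec_mx_factor k x l a :
  vec_mx (factor k x) l a = (l == k)%:R * vec_mx x l a.
Proof. by rewrite mxvecK mxE. Qed.

Lemma factorK k x : factor k (factor k x) = factor k x.
Proof.
apply: vec_mxP; apply/matrixP => l a; rewrite !vec_mx_factor.
by case: (l == k); rewrite ?mul1r ?mul0r.
Qed.

Lemma factor_ad k x y : factor k x *m su2_ad y = factor k (x *m su2_ad y).
Proof.
apply: vec_mxP; rewrite vec_mx_su2_ad; apply/matrixP => l a.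
rewrite vec_mx_factor vec_mx_su2_ad; move: a.
by apply: forall3; rewrite !mxE /= !mxvecE !mxE; ring.
Qed.

Lemma factor_adl k x y : x *m su2_ad (factor k y) = factor k (x *m su2_ad y).
Proof.
rewrite su2_adC factor_ad su2_adC; apply: vec_mxP; rewrite linearN /=.
by apply/matrixP => l a; rewrite mxE !vec_mx_factor linearN /= !mxE; ring.
Qed.

Lemma factor0 k : factor k 0 = 0.
Proof.
by apply: vec_mxP; apply/matrixP => l a;
  rewrite vec_mx_factor linear0 !mxE mulr0.
Qed.

Lemma factor_neq0 x : x != 0 -> exists k, factor k x != 0.
Proof.
move=> x0; apply/existsP; apply: contraNT x0;
  rewrite negb_exists => /forallP x0.
apply/eqP/vec_mxP/matrixP => k a; have := x0 k; rewrite negbK => /eqP.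
move/(congr1 (fun y => vec_mx y k a)); rewrite vec_mx_factor eqxx mul1r => ->.
by rewrite linear0.
Qed.

Lemma su2_center x : su2_ad x = 0 -> x = 0.
Proof.
move=> ad0; apply: vec_mxP; rewrite linear0; apply/matrixP => k a; rewrite mxE.
have br0 b c : bracket (vec_mx x) (delta_mx k b) k c = 0.
  by rewrite -[delta_mx k b]mxvecK -vec_mx_su2_ad ad0 mulmx0 linear0 mxE.
have := br0 o0 o1; have := br0 o0 o2; have := br0 o1 o2.
by move: a; apply: forall3; rewrite !mxE !eqxx /= => *; lra.
Qed.

Definition sqlen k x :=
  vec_mx x k o0 ^+ 2 + vec_mx x k o1 ^+ 2 + vec_mx x k o2 ^+ 2.

Lemma sqlen_ge0 k x : 0 <= sqlen k x.
Proof. by rewrite !addr_ge0 ?sqr_ge0. Qed.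

Lemma sqlen_factor k x : (sqlen k x == 0) = (factor k x == 0).
Proof.
apply/eqP/eqP => [/eqP|x0]; last first.
  have c a : vec_mx x k a = 0.
    have := congr1 (fun y => vec_mx y k a) x0.
    by rewrite vec_mx_factor eqxx mul1r linear0 => ->; rewrite mxE.
  by rewrite /sqlen !c expr2 mulr0 !addr0.
rewrite /sqlen !paddr_eq0 ?addr_ge0 ?sqr_ge0 // !sqrf_eq0.
case/andP => /andP [/eqP c0 /eqP c1] /eqP c2.
apply: vec_mxP; apply/matrixP => l a; rewrite vec_mx_factor linear0 [RHS]mxE.
have [->|_] := eqVneq l k; last by rewrite mul0r.
rewrite mul1r.
by move: a; apply: forall3.
Qed.

Lemma vec_mx_mul_factor_ad k z y
    (Z := vec_mx z) (Y := vec_mx y) (c := vec_mx (y *m su2_ad (factor k z))) :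
  [/\ c k o0 = 2 * (Z k o1 * Y k o2 - Z k o2 * Y k o1),
      c k o1 = 2 * (Z k o2 * Y k o0 - Z k o0 * Y k o2),
      c k o2 = 2 * (Z k o0 * Y k o1 - Z k o1 * Y k o0)
    & forall l a, l != k -> c l a = 0].
Proof.
rewrite /c factor_adl; split;
  rewrite ?vec_mx_factor ?eqxx ?mul1r ?vec_mx_su2_ad;
  try exact: mxE.
by move=> l a /negPf lk; rewrite vec_mx_factor lk mul0r.
Qed.

(** In one copy of R^3: z x (z x (z x p)) = - |z|^2 z x p, with a factor 2 for
    each bracket. *)
Lemma factor_ad3 k z p (A := su2_ad (factor k z)) :
  p *m A *m A *m A = - (4 * sqlen k z) *: (p *m A).
Proof.
apply: vec_mxP; rewrite linearZ /= /A; apply/matrixP => l a; rewrite [RHS]mxE.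
have [p0 p1 p2 pl] := vec_mx_mul_factor_ad k z p.
have [q0 q1 q2 _] := vec_mx_mul_factor_ad k z (p *m A).
have [r0 r1 r2 rl] := vec_mx_mul_factor_ad k z (p *m A *m A).
have [->|lk] := eqVneq l k; last by rewrite rl // pl // mulr0.
move: a; apply: forall3; rewrite ?(r0, r1, r2) ?(q0, q1, q2) ?(p0, p1, p2)
  /sqlen; ring.
Qed.

Definition dot k x y := vec_mx x k o0 * vec_mx y k o0
  + vec_mx x k o1 * vec_mx y k o1 + vec_mx x k o2 * vec_mx y k o2.

(** The expansion of w in the orthogonal basis z, e, z x e of R^3, cleared of
    denominators; w has no component along z as it is itself a bracket with
    z. *)
Lemma factor_ad_lagrange k z p q (A := su2_ad (factor k z))
    (e := p *m A) (w := q *m A) (f := e *m A) :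
  (4 * sqlen k z * sqlen k e) *: w =
    (4 * sqlen k z * dot k w e) *: e + dot k w f *: f.
Proof.
apply: vec_mxP; rewrite linearD !linearZ /=; apply/matrixP => l a.
rewrite [LHS]mxE [RHS]mxE [X in _ = X + _]mxE [X in _ = _ + X]mxE.
have [p0 p1 p2 pl] := vec_mx_mul_factor_ad k z p.
have [q0 q1 q2 ql] := vec_mx_mul_factor_ad k z q.
have [r0 r1 r2 rl] := vec_mx_mul_factor_ad k z (p *m A).
have [->|lk] := eqVneq l k; last by rewrite rl // pl // ql // !mulr0 addr0.
move: a; apply: forall3; rewrite /dot /sqlen /f /e /w ?(r0, r1, r2)
  ?(q0, q1, q2) ?(p0, p1, p2); ring.
Qed.

Lemma factor_ad_plane k z p q (A := su2_ad (factor k z)) :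
  p *m A != 0 -> exists s t, q *m A = s *: (p *m A) + t *: (p *m A *m A).
Proof.
move=> pA0; set D := 4 * sqlen k z * sqlen k (p *m A).
have D0 : D != 0.
  rewrite /D !mulf_neq0 ?pnatr_eq0 // sqlen_factor.
    by apply: contra_neq pA0 => z0; rewrite /A z0 linear0 mulmx0.
  by rewrite /A factor_adl factorK -factor_adl.
exists (4 * sqlen k z * dot k (q *m A) (p *m A) / D).
exists (dot k (q *m A) (p *m A *m A) / D).
apply: (scalerI D0); rewrite scalerDr !scalerA ![D * _]mulrC !divfK //.
exact: factor_ad_lagrange.
Qed.

(** The vector u dual to X |-> tr (I ad (IX)) is the same for J.  The bracket with
    its component in a factor of su(2)^m commutes with both structures, but has
    a plane as image. *)
Lemma no_hypercomplex_matrices (I J : 'M[R]_(m * 3)) : (0 < m)%N ->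
  I *m I = - 1%:M -> J *m J = - 1%:M -> I *m J = - (J *m I) ->
  integrable su2_ad I -> integrable su2_ad J -> integrable su2_ad (J *m I) ->
  False.
Proof.
move=> m_gt0 I2 J2 IJ N_I N_J N_K.
have [x adx0] : exists x, su2_ad x != 0.
  pose k := Ordinal m_gt0; exists (mxvec (delta_mx k o0)).
  apply/eqP => /su2_center /(congr1 (fun x => vec_mx x k o0)).
  by rewrite mxvecK linear0 !mxE !eqxx => /eqP; rewrite oner_eq0.
have v0 := koszul_neq0 su2_ad_skew su2_adC su2_ad_bracket I2 N_I
  (ex_intro _ x adx0).
have uJ := koszul_form_eq I2 J2 IJ N_K.
(* z is the component in factor k of the vector dual to X |-> tr (L ad (LX)). *)
have comm (L : 'M[R]_(m * 3)) k (z := factor k (koszul su2_ad L *m L^T)) :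
    L *m L = - 1%:M -> integrable su2_ad L -> L *m su2_ad z = su2_ad z *m L.
  move=> L2 N_L; set v := koszul su2_ad L.
  have vv : v *m su2_ad v = 0.
    apply: vec_mxP; rewrite vec_mx_su2_ad linear0; apply/matrixP => l.
    by apply: forall3; rewrite !mxE /=; ring.
  (* a commutes with v, so L commutes with ad a, so a commutes with
     u = [v *m L^T]; hence the components of u and v in factor k commute. *)
  pose a := factor k v.
  have av : a *m su2_ad v = 0 by rewrite factor_ad vv factor0.
  have La := commutes_of_koszul_commutes su2_ad_skew su2_adC su2_ad_bracket
    L2 N_L av.
  have := koszul_form_commutes su2_ad_skew su2_adC La av.
  rewrite -/v factor_ad -factor_adl => vz.
  apply: (commutes_of_koszul_commutes su2_ad_skew su2_adC su2_ad_bracket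
    L2 N_L).
  by rewrite su2_adC vz oppr0.
have u0 : koszul su2_ad I *m I^T != 0.
  apply: contra_neq v0 => u0; have := congr1 (fun u => u *m I^T) u0.
  rewrite mul0mx -mulmxA trII // mulmxN mulmx1 => /eqP.
  by rewrite oppr_eq0 => /eqP.
have [k z0] := factor_neq0 u0.
have IA := comm I k I2 N_I.
have := comm J k J2 N_J; rewrite -uJ => JA.
have two0 : (2 : R) != 0 by rewrite pnatr_eq0.
move: z0; rewrite (su2_center (quaternions_not_on_plane two0 I2 J2 IJ IA JA
  (@factor_ad_plane k _) (@factor_ad3 k _))).
by rewrite eqxx.
Qed.
End Su2Power.

(** * One-parameter subgroups *)

Section Trig.
Variable R : realType.
Definition trig (a b r : R) (t : R) : R := a * cos (r * t) + b * sin (r * t).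

Lemma is_derive_trig a b r (t : R) :
  is_derive t 1 (trig a b r) (trig (b * r) (- a * r) r t).
Proof.
have dr : is_derive t 1 (fun s : R => r * s) r.
  by apply: (is_derive_eq (is_deriveZ r (is_derive_id t 1)));
    rewrite /GRing.scale /= mulr1.
have dc := is_derive1_comp (is_derive_cos (r * t)) dr.
have ds := is_derive1_comp (is_derive_sin (r * t)) dr.
apply: (is_derive_eq (is_deriveD (is_deriveZ a dc) (is_deriveZ b ds))).
rewrite /trig /GRing.scale /=; ring.
Qed.

Lemma smooth_trig a b r : smooth (trig a b r).
Proof.
move=> n t; suff [c [d ->]] :
    exists c d, (trig a b r)^`(n)%classic = trig c d r.
  by have [] := is_derive_trig c d r t.
elim: n => [|n [c [d IH]]]; first by exists a, b; rewrite derive1n0.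
exists (d * r), (- c * r); rewrite derive1nS IH; apply/funext => s.
by rewrite derive1E; apply: (derive_val (is_derive := is_derive_trig c d r s)).
Qed.
End Trig.

(** * The group SU(2) *)

Section SU2.
Variable R : realType.
Local Notation C := R[i].

Lemma complex_eq (x y : C) : complex.Re x = complex.Re y ->
  complex.Im x = complex.Im y -> x = y.
Proof. by case: x y => [a b] [c d] /= -> ->. Qed.

Lemma forall2 (P : 'I_2 -> Prop) : P 0 -> P 1 -> forall i, P i.
Proof.
move=> P0 P1 [[|[|//]] lt_i2].
- by rewrite (_ : Ordinal _ = 0) //; apply: val_inj.
- by rewrite (_ : Ordinal _ = 1) //; apply: val_inj.
Qed.

Lemma sum2 (V : nmodType) (F : 'I_2 -> V) : \sum_i F i = F 0 + F 1.
Proof.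
by rewrite !big_ord_recl big_ord0 addr0; congr (_ + F _); apply: val_inj.
Qed.

Lemma det2 (K : comPzRingType) (A : 'M[K]_2) :
  \det A = A 0 0 * A 1 1 - A 0 1 * A 1 0.
Proof.
rewrite (expand_det_row _ 0) sum2 /cofactor !det_mx11 !mxE /= expr0 expr1 mul1r.
rewrite (_ : lift 0 0 = 1); last exact: val_inj.
rewrite (_ : lift 1 0 = 0); last exact: val_inj.
ring.
Qed.

(** The quaternion x + y i + z j + w k as a complex matrix. *)
Definition quatmx (x y z w : R) : 'M[C]_2 := \matrix_(i, j)
  if i == 0 then if j == 0 then x +i* y else z +i* w
  else if j == 0 then (- z) +i* w else x +i* (- y).

Lemma quatmxE x y z w i j : quatmx x y z w i j =
  if i == 0 then if j == 0 then x +i* y else z +i* w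
  else if j == 0 then (- z) +i* w else x +i* (- y).
Proof. exact: mxE. Qed.

Lemma quatmx_SU2 x y z w : x ^+ 2 + y ^+ 2 + z ^+ 2 + w ^+ 2 = 1 ->
  SU2 R (quatmx x y z w).
Proof.
move=> n1; split.
  apply/unitarymxP/matrixP; apply: forall2; apply: forall2;
    rewrite !mxE sum2 !mxE /=;
  apply: complex_eq => /=; rewrite ?n1; try ring.
all: try (by rewrite -n1; ring).
rewrite det2 !mxE /=; apply: complex_eq => /=; first by rewrite -n1; ring.
ring.
Qed.

(** U^* = U^-1 is the adjugate of U, which gives the second row. *)
Lemma SU2_quatmx (U : 'M[C]_2)
  (x := complex.Re (U 0 0)) (y := complex.Im (U 0 0))
  (z := complex.Re (U 0 1)) (w := complex.Im (U 0 1)) :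
  SU2 R U -> U = quatmx x y z w /\ x ^+ 2 + y ^+ 2 + z ^+ 2 + w ^+ 2 = 1.
Proof.
case=> /unitarymxP UU; rewrite det2 => dU.
have u00 := congr1 (fun A : 'M[C]_2 => A 0 0) UU.
have u01 := congr1 (fun A : 'M[C]_2 => A 0 1) UU.
move: u00 u01; have conjE (v : C) : Num.conj v = conjc v by [].
rewrite !mxE !sum2 !mxE /= !conjE => u00 /(congr1 conjc).
rewrite conjc0 rmorphD !rmorphM /= !conjcK => u01; split.
  (* Multiply the entry by the squared norm of the first row, which is 1. *)
  have U11 : U 1 1 = (U 0 0)^*.
    have : U 1 1 * (U 0 0 * (U 0 0)^* + U 0 1 * (U 0 1)^*) =
      (U 0 0)^* * (U 0 0 * U 1 1 - U 0 1 * U 1 0)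
      + U 0 1 * ((U 0 0)^* * U 1 0 + (U 0 1)^* * U 1 1) by ring.
    by rewrite u00 u01 dU !mulr1 mulr0 addr0.
  have U10 : U 1 0 = - (U 0 1)^*.
    have : U 1 0 * (U 0 0 * (U 0 0)^* + U 0 1 * (U 0 1)^*) =
      U 0 0 * ((U 0 0)^* * U 1 0 + (U 0 1)^* * U 1 1)
      - (U 0 1)^* * (U 0 0 * U 1 1 - U 0 1 * U 1 0) by ring.
    by rewrite u00 u01 dU !mulr1 mulr0 add0r.
  apply/matrixP; apply: forall2; apply: forall2;
    rewrite mxE /= /x /y /z /w ?U10 ?U11.
  - by case: (U 0 0).
  - by case: (U 0 1).
  - by case: (U 0 1) => a b; apply: complex_eq; rewrite //= opprK.
  - by case: (U 0 0).
move/(congr1 (@complex.Re _)): u00; rewrite /x /y /z /w;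
  case: (U 0 0) (U 0 1) => a b [c d] /= <-; ring.
Qed.

End SU2.

(** * The tangent space of SU(2)^m at the identity *)

Section LieAlgebra.
Variables (R : realType) (m : nat).
Implicit Types (x y : 'rV[R]_(m * 3)) (X Y : ambient R m).
Local Notation su2m := (lie_algebra (SU2_pow R m)).

Definition of_coords x : ambient R m :=
  [ffun k => quatmx 0 (vec_mx x k o0) (vec_mx x k o1) (vec_mx x k o2)].

Definition coords X : 'rV[R]_(m * 3) := mxvec (\matrix_(k, a) nth 0
  [:: complex.Im (X k 0 0); complex.Re (X k 0 1); complex.Im (X k 0 1)] a).

Lemma of_coordsK : cancel of_coords coords.
Proof.
move=> x; apply: vec_mxP; rewrite mxvecK; apply/matrixP => k.
by apply: forall3; rewrite mxE /= ffunE mxE.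
Qed.

Lemma of_coords_linear a x y :
  of_coords (a *: x + y) = a%:C *: of_coords x + of_coords y.
Proof.
apply/ffunP => k; rewrite !ffunE; apply/matrixP.
by apply: forall2; apply: forall2; rewrite !mxE /=; apply: complex_eq;
  rewrite /= ?mxE; ring.
Qed.

Lemma coords_linear a X Y : coords (a%:C *: X + Y) = a *: coords X + coords Y.
Proof.
apply: vec_mxP; rewrite linearP /= !mxvecK; apply/matrixP => k.
apply: forall3; rewrite !mxE /= !ffunE !mxE /=.
- by case: (X k 0 0) (Y k 0 0) => ? ? [? ?] /=; ring.
- by case: (X k 0 1) (Y k 0 1) => ? ? [? ?] /=; ring.
- by case: (X k 0 1) (Y k 0 1) => ? ? [? ?] /=; ring.
Qed.

Lemma lie_bracket_of_coords x y :
  lie_bracket (of_coords x) (of_coords y) = of_coords (y *m su2_ad x).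
Proof.
apply/ffunP => k; rewrite !ffunE vec_mx_su2_ad; apply/matrixP.
by apply: forall2; apply: forall2; rewrite !(mxE, sum2) /=;
  apply: complex_eq; rewrite /= ?mxE /=; ring.
Qed.

Lemma eq_fun_is_derive (f g : R -> R) (t a b : R) :
  is_derive t (1 : R) f a -> is_derive t (1 : R) g b -> f =1 g -> a = b.
Proof. by move=> [_ <-] [_ <-] /funext ->. Qed.

Lemma coordsK X : su2m X -> of_coords (coords X) = X.
Proof.
case=> c [_ Gc c0 vX]; apply/ffunP => k; rewrite ffunE /coords mxvecK !mxE /=.
have Uk t := SU2_quatmx (Gc t k).
have [vx vy] := vX k 0 0; have [vz vw] := vX k 0 1.
have [vr vr'] := vX k 1 0; have [vs vs'] := vX k 1 1.
have Us i j t := congr1 (fun A : 'M[R[i]]_2 => A i j) (Uk t).1.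
have c0k i j : c 0 k i j = (i == j)%:R by rewrite c0 ffunE mxE.
(* The first row has norm 1 and starts at (1, 0), so the derivative of its
   squared norm at 0 is twice this real part. *)
have re00 : complex.Re (X k 0 0) = 0.
  have d2 := is_deriveD (is_deriveD (is_deriveD (is_deriveX 2 vx)
    (is_deriveX 2 vy)) (is_deriveX 2 vz)) (is_deriveX 2 vw).
  have := eq_fun_is_derive d2 (is_derive_cst (1 : R) (0 : R) (1 : R))
    (fun t => (Uk t).2).
  by rewrite !c0k /GRing.scale /= => h; lra.
apply/matrixP; apply: forall2; apply: forall2; rewrite mxE /=;
  apply: complex_eq => //=.
- by apply: (eq_fun_is_derive (is_deriveN vz) vr) => t; rewrite [in RHS]Us mxE.
- by apply: (eq_fun_is_derive vw vr') => t; rewrite [in RHS]Us mxE.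
- apply: etrans (esym re00) _.
  by apply: (eq_fun_is_derive vx vs) => t; rewrite [in RHS]Us mxE.
- by apply: (eq_fun_is_derive (is_deriveN vy) vs') => t; rewrite [in RHS]Us mxE.
Qed.

(** The curve cos (n t) + sin (n t) / n X, for X with X^2 = - n^2. *)
Lemma lie_algebra_of_coords x : su2m (of_coords x).
Proof.
pose n k : R := Num.sqrt (sqlen k x).
pose e k a : R -> R := trig 0 (vec_mx x k a / n k) (n k).
pose c (t : R) : ambient R m := [ffun k =>
  quatmx (trig 1 0 (n k) t) (e k o0 t) (e k o1 t) (e k o2 t)].
have trigN a b r t : - trig a b r t = trig (- a) (- b) r t :> R.
  by rewrite /trig; ring.
(* For n = 0 the coordinates vanish, and the quotients are 0 by convention. *)
have n0 k a : vec_mx x k a / n k * n k = vec_mx x k a.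
  have [nk0|] := eqVneq (n k) 0; last by move=> ?; rewrite divfK.
  rewrite nk0 mulr0; move/eqP: nk0; rewrite sqrtr_eq0 => nk0.
  have : sqlen k x == 0 by rewrite eq_le nk0 sqlen_ge0.
  rewrite sqlen_factor => /eqP/(congr1 (fun y => vec_mx y k a)).
  by rewrite vec_mx_factor eqxx mul1r linear0 => ->; rewrite mxE.
have entry k i j : exists a b a' b',
    [/\ (fun t => complex.Re (c t k i j)) = trig a b (n k),
        (fun t => complex.Im (c t k i j)) = trig a' b' (n k),
        b * n k = complex.Re (of_coords x k i j) &
        b' * n k = complex.Im (of_coords x k i j)].
  have tr0 t : trig 0 0 (n k) t = 0 by rewrite /trig; ring.
  move: i j; apply: forall2; apply: forall2;
    [exists 1, 0, 0, (vec_mx x k o0 / n k)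
    |exists 0, (vec_mx x k o1 / n k), 0, (vec_mx x k o2 / n k)
    |exists 0, (- (vec_mx x k o1 / n k)), 0, (vec_mx x k o2 / n k)
    |exists 1, 0, 0, (- (vec_mx x k o0 / n k))];
  rewrite !ffunE !quatmxE /= ?(mulNr _ (n k)) ?n0 ?mul0r; split=> //;
  by apply/funext => t; rewrite ffunE quatmxE /= ?trigN ?oppr0 ?tr0.
exists c; split.
- move=> k i j; have [a [b [a' [b' [-> -> _ _]]]]] := entry k i j.
  by split; apply: smooth_trig.
- move=> t k; rewrite ffunE; apply: quatmx_SU2.
  have -> : trig 1 0 (n k) t ^+ 2
      + e k o0 t ^+ 2 + e k o1 t ^+ 2 + e k o2 t ^+ 2
      = cos (n k * t) ^+ 2 + sqlen k x * (n k)^-1 ^+ 2 * sin (n k * t) ^+ 2.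
    by rewrite /e /trig /sqlen; move: (n k)^-1 => v; ring.
  have [nk0|nk0] := eqVneq (n k) 0.
    by rewrite nk0 mul0r cos0 sin0; ring.
  by rewrite -[sqlen k x]sqr_sqrtr ?sqlen_ge0 // exprVn divff ?mul1r
    ?cos2Dsin2 ?expf_neq0.
- apply/ffunP => k; rewrite !ffunE /e /trig mulr0 cos0 sin0; apply/matrixP.
  by apply: forall2; apply: forall2; rewrite [RHS]mxE quatmxE /=;
    apply: complex_eq => /=; ring.
move=> k i j; have [a [b [a' [b' [-> -> <- <-]]]]] := entry k i j.
have d0 u v : is_derive (0 : R) 1 (trig u v (n k)) (v * n k).
  apply: (is_derive_eq (is_derive_trig u v (n k) 0)).
  by rewrite /trig mulr0 cos0 sin0; ring.
by split; apply: d0.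
Qed.

End LieAlgebra.

(** * Left-invariant hypercomplex structures on SU(2)^m *)

Theorem theorem1p1 (R : realType) (m : nat) (hm : (1 <= m)%N) :
  ~ admits_left_invariant_hypercomplex (SU2_pow R m).
Proof.
case=> I [J [K [[[linI I2 NI] [linJ J2 NJ] [linK K2 NK]] [aIJ _ _ IJK]]]].
pose phi := @of_coords R m.
have phi_lin a x y : phi (a *: x + y) = a%:C *: phi x + phi y :=
  of_coords_linear a x y.
have phiD x y : phi (x + y) = phi x + phi y.
  by rewrite -[x in LHS]scale1r phi_lin (_ : 1%:C = 1) ?scale1r.
have phi0 : phi 0 = 0 by apply: (addrI (phi 0)); rewrite -phiD !addr0.
have phiN x : phi (- x) = - phi x.
  by apply/eqP; rewrite -addr_eq0 -phiD addNr phi0.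
have phi_inj : injective phi := can_inj (@of_coordsK R m).
have gphi x : lie_algebra (SU2_pow R m) (phi x) by exact: lie_algebra_of_coords.
have act L : linear_endo (lie_algebra (SU2_pow R m)) L ->
    exists A : 'M[R]_(m * 3), forall x, L (phi x) = phi (x *m A).
  case=> Lg Llin.
  have lin : linear (@coords R m \o L \o phi).
    by move=> a x y; rewrite /= phi_lin Llin // coords_linear.
  pose f : {linear 'rV[R]_(m * 3) -> 'rV[R]_(m * 3)} :=
    HB.pack (@coords R m \o L \o phi) (GRing.isLinear.Build R _ _ _ _ lin).
  exists (lin1_mx f) => x; rewrite mul_rV_lin1 /= /phi coordsK //.
  by apply: Lg.
have sq L A : (forall X, lie_algebra (SU2_pow R m) X -> L (L X) = - X) ->
    (forall x, L (phi x) = phi (x *m A)) -> A *m A = - 1%:M.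
  move=> L2 LA; apply: mulmx_rowP => x; apply: phi_inj.
  by rewrite mulmxA -!LA L2 // -phiN mulmxN mulmx1.
have N L A : (forall X Y, lie_algebra (SU2_pow R m) X ->
      lie_algebra (SU2_pow R m) Y -> nijenhuis L X Y = 0) ->
    (forall x, L (phi x) = phi (x *m A)) -> integrable (@su2_ad R m) A.
  move=> NL LA x; apply: mulmx_rowP => y; apply: phi_inj; rewrite mulmx0 phi0.
  rewrite -(NL _ _ (gphi x) (gphi y)) /nijenhuis !LA !lie_bracket_of_coords !LA.
  rewrite -phiN -!phiD; congr phi; rewrite !mulmxDr mulmxN !mulmxA.
  by rewrite -!addrA; congr (_ + _); rewrite addrC -!addrA.
have [A IA] := act I linI; have [B JB] := act J linJ.
have KBA x : K (phi x) = phi (x *m (B *m A)) by rewrite -IJK // JB IA mulmxA.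
apply: (@no_hypercomplex_matrices R m A B hm (sq _ _ I2 IA) (sq _ _ J2 JB) _
  (N _ _ NI IA) (N _ _ NJ JB) (N _ _ NK KBA)).
apply: mulmx_rowP => x; apply: phi_inj.
by rewrite mulmxN phiN !mulmxA -JB -!IA -JB aIJ ?opprK.
Qed.
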